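(* Let $\chi^{ab}$, $1\le a,b\le n$, be a family of $(p,0)$-forms on $J^\infty\mathrm{Lor}$ such that $\chi^{ab}=-\chi^{ba}$. Then $$\nabla_a\chi^{ab}\wedge\iota_{\hat\partial_b}\mathrm{vol}_g=(-1)^p\,d\bigl(\tfrac12\chi^{ab}\wedge\iota_{\hat\partial_a}\iota_{\hat\partial_b}\mathrm{vol}_g\bigr).$$
   Context: $M$ is a smooth manifold of dimension $n$ and $\mathrm{Lor}\to M$ is the bundle of fibre-wise lorentzian metrics (signature $(-1,1,\dots,1)$). $J^\infty\mathrm{Lor}$ is its infinite jet bundle; $\Omega^{p,q}(J^\infty\mathrm{Lor})$ is the space of forms of vertical degree $p$ and horizontal degree $q$ in the variational bicomplex, with vertical differential $\delta$, horizontal differential $d$, total differential $\mathbf{d}=\delta+d$, and $\mathcal{L}_X=[\iota_X,\mathbf{d}]$. Repeated indices are summed. One works over a coordinate chart of $M$ with coordinates $x^a$ and induced jet coordinates $g_{ab,C}(j^\infty_x\eta)=\partial^{|C|}\eta_{ab}/\partial x^C|_x$, so that $\delta x^a=0$, $dg_{ab,C}=g_{ab,Ce}\,dx^e$, $d\,\delta g_{ab,C}=-\delta g_{ab,Ce}\wedge dx^e$. $\hat\partial_a$ is the horizontal lift of $\partial/\partial x^a$ by the Cartan connection: $\iota_{\hat\partial_a}dx^b=\delta^b_a$, $\iota_{\hat\partial_a}\delta g_{bc,D}=0$. The metric volume form is $\mathrm{vol}_g=\sqrt{-\det g}\;dx^1\wedge\dots\wedge dx^n\in\Omega^{0,n}$.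 With $\Gamma^a_{bc}=\tfrac12g^{ad}(g_{db,c}+g_{dc,b}-g_{bc,d})$, viewed as functions on the jet bundle ($(g^{ab})$ the inverse of $(g_{ab})$), the covariant derivative of a family with two upper indices is $\nabla_c\chi^{ab}=\mathcal{L}_{\hat\partial_c}\chi^{ab}+\Gamma^a_{ce}\chi^{eb}+\Gamma^b_{ce}\chi^{ae}$. *)

(* Defs.v *)
From HB Require Import structures.
From mathcomp Require Import all_boot all_order all_algebra.
From mathcomp Require Import all_classical all_reals all_analysis.
Set Implicit Arguments.
Unset Strict Implicit.
Unset Printing Implicit Defensive.
Import Order.TTheory GRing.Theory Num.Theory.
Import numFieldNormedType.Exports.
Local Open Scope classical_set_scope.
Local Open Scope ring_scope.

(** * The infinite jet bundle of lorentzian metrics over a chart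

   The chart is an open set [U] of R^n.  A point of the infinite jet bundle of
   symmetric 2-tensors over R^n is given by its coordinates x^a and
   g_{ab,C} = g_{ba,C}, with C a multi-index, [C i] being the number of
   derivatives in the direction x^i. *)

Definition multiidx (n : nat) : countType := {ffun 'I_n -> nat}.

(* Unordered pairs {a, b}, represented by a <= b: g_{ab,C} and g_{ba,C} are the
   same coordinate. *)
Definition sympair (n : nat) : countType :=
  {ab : 'I_n * 'I_n | (ab.1 <= ab.2)%N}.

Lemma sort_subproof n (a b : 'I_n) :
  let ab := if (a <= b)%N then (a, b) else (b, a) in (ab.1 <= ab.2)%N.
Proof. by case: leqP => //= /ltnW. Qed.

Definition spair n (a b : 'I_n) : sympair n :=
  exist (fun ab : 'I_n * 'I_n => is_true (ab.1 <= ab.2)%N) _ (sort_subproof a b).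

(* Names of the coordinates; the same type indexes the coframe
   (dx^a, delta g_{ab,C}) and its dual frame. *)
Definition jetidx (n : nat) : countType :=
  ('I_n + sympair n * multiidx n)%type.

Definition ix n (a : 'I_n) : jetidx n := inl a.
Definition ig n (a b : 'I_n) (C : multiidx n) : jetidx n := inr (spair a b, C).

Definition mi0 n : multiidx n := [ffun=> 0%N].
Definition mi_add n (C : multiidx n) (e : 'I_n) : multiidx n :=
  [ffun i => (C i + (i == e))%N].
Definition mi_sub n (C : multiidx n) (e : 'I_n) : multiidx n :=
  [ffun i => (C i - (i == e))%N].

Definition idx_order n (k : jetidx n) : nat :=
  if k is inr (_, C) then (\sum_i C i)%N else 0%N.

Section JetSpace.
Variables (R : realType) (n : nat).

Definition jetpt := jetidx n -> R.

Definition base (c : jetpt) : 'rV[R]_n := \row_a c (ix a).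
Definition gmat (c : jetpt) : 'M[R]_n := \matrix_(a, b) c (ig a b (mi0 n)).

(* Signature (-1, 1, ..., 1), by Sylvester normal form. *)
Definition lorentzian (g : 'M[R]_n) : Prop :=
  exists (i0 : 'I_n) (P : 'M[R]_n), P \in unitmx /\
    g = P^T *m diag_mx (\row_i (if i == i0 then -1 else 1)) *m P.

Definition JLor (U : set 'rV[R]_n) : set jetpt :=
  [set c | U (base c) /\ lorentzian (gmat c)].

(** * Functions on the jet bundle *)

Definition upd (c : jetpt) (k : jetidx n) (t : R) : jetpt :=
  fun j => if j == k then t else c j.

Definition pd (k : jetidx n) (f : jetpt -> R) : jetpt -> R :=
  fun c => derive1 (fun t => f (upd c k t) : R^o) (c k).

Definition smooth_on (W : set jetpt) (f : jetpt -> R) : Prop :=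
  forall (ks : seq (jetidx n)) (c : jetpt), W c ->
    {for c, continuous (foldr pd f ks : {ptws jetidx n -> R} -> R)} /\
    forall k, derivable (fun t => foldr pd f ks (upd c k t)) (c k) 1.

Definition order_le_on (W : set jetpt) (m : nat) (f : jetpt -> R) : Prop :=
  forall c c' : jetpt, W c -> W c' ->
    (forall k, (idx_order k <= m)%N -> c k = c' k) -> f c = f c'.

(* The total derivative d/dx^e + g_{ab,Ce} d/dg_{ab,C}, summed over the
   coordinates g_{ab,C}, that is over a <= b and C; this is the horizontal lift
   of d/dx^e acting on functions.  The sum is finite when f has finite order. *)
Definition total_deriv (e : 'I_n) (f : jetpt -> R) : jetpt -> R :=
  fun c => pd (ix e) f c +
    \sum_(J \in [set: sympair n * multiidx n])
       c (inr (J.1, mi_add J.2 e)) * pd (inr J) f c.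

(** * Differential forms

   A form is given at each point by its values on the finite sequences of
   vectors of the frame dual to (dx^a, delta g_{ab,C}); all degrees are summed
   together.  Values at points outside [JLor U] are irrelevant. *)

Definition jform := jetpt -> seq (jetidx n) -> R^o.

Definition eq_form (W : set jetpt) (u v : jform) : Prop :=
  forall c, W c -> u c = v c.

Definition is_vert (k : jetidx n) : bool := if k is inr _ then true else false.

(* The forms on J^oo, i.e. the colimit over m of the forms on the J^m. *)
Definition is_form (W : set jetpt) (w : jform) : Prop :=
  [/\ (forall s, smooth_on W (fun c => w c s)),
      (exists m, (forall s, order_le_on W m (fun c => w c s)) /\
         forall s c, W c -> has (fun k => (m < idx_order k)%N) s -> w c s = 0)
    & forall c s1 k l s2, W c ->
        w c (s1 ++ k :: l :: s2) = - w c (s1 ++ l :: k :: s2)].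

(* Omega^{p,q}: vertical degree p and horizontal degree q. *)
Definition Omega (W : set jetpt) (p q : nat) (w : jform) : Prop :=
  is_form W w /\
  forall c s, W c -> w c s != 0 ->
    count is_vert s = p /\ count (predC is_vert) s = q.

Definition fun_form (f : jetpt -> R) : jform :=
  fun c s => if s is [::] then f c else 0.

Definition coframe (k : jetidx n) : jform := fun c s => (s == [:: k])%:R.
Definition dx (a : 'I_n) : jform := coframe (ix a).
Definition deltag (a b : 'I_n) (C : multiidx n) : jform := coframe (ig a b C).

(* Wedge product of alternating forms, by
   iota_k (u /\ v) = iota_k u /\ v + (-1)^|u| u /\ iota_k v;
   unfolded, this is the sum over shuffles with signs (without factorials). *)
Fixpoint wedge_at (u v : seq (jetidx n) -> R) (s : seq (jetidx n)) : R :=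
  if s is k :: s' then
    wedge_at (fun t => u (k :: t)) v s' +
    wedge_at (fun t => (-1) ^+ size t * u t) (fun t => v (k :: t)) s'
  else u [::] * v [::].

Definition wedge (u v : jform) : jform := fun c => wedge_at (u c) (v c).

Definition fscale (f : jetpt -> R) (w : jform) : jform :=
  fun c s => f c * w c s.

Definition iota_frame (k : jetidx n) (w : jform) : jform :=
  fun c s => w c (k :: s).

(* Interior product with the horizontal lift of d/dx^a, the dual frame vector
   that takes dx^b to delta^b_a and every delta g_{bc,D} to 0. *)
Definition iprod (a : 'I_n) (w : jform) : jform := iota_frame (ix a) w.

(** * The variational bicomplex *)

(* The derivation of the exterior algebra extending the total derivative along
   x^e by dx^b |-> 0 and delta g_{ab,C} |-> delta g_{ab,Ce}.  On values, the
   latter substitutes in turn the frame vector at (ab, C) by the one at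
   (ab, C - e), or by 0 if C does not contain e. *)
Definition lower (e : 'I_n) (k : jetidx n) : option (jetidx n) :=
  if k is inr (ab, C) then
    if (0 < C e)%N then Some (inr (ab, mi_sub C e)) else None
  else None.

Fixpoint shift_at (e : 'I_n) (u : seq (jetidx n) -> R) (s : seq (jetidx n)) : R :=
  if s is k :: s' then
    (if lower e k is Some k' then u (k' :: s') else 0) +
    shift_at e (fun t => u (k :: t)) s'
  else 0.

Definition total_deriv_form (e : 'I_n) (w : jform) : jform :=
  fun c s => total_deriv e (fun c' => w c' s) c + shift_at e (w c) s.

(* Horizontal differential d = dx^e /\ D_e.  It satisfies
   d g_{ab,C} = g_{ab,Ce} dx^e and d delta g_{ab,C} = - delta g_{ab,Ce} /\ dx^e;
   see [dh_g] and [dh_deltag]. *)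
Definition dh (w : jform) : jform := \sum_(e < n) wedge (dx e) (total_deriv_form e w).

Definition pd_form (k : jetidx n) (w : jform) : jform :=
  fun c s => pd k (fun c' => w c' s) c.

(* Vertical differential, delta = delta g_{ab,C} /\ d/dg_{ab,C} (on the
   coefficients), summed over the coordinates g_{ab,C}.  Every value is a
   finite sum. *)
Definition dv (w : jform) : jform :=
  fun c s => \sum_(J \in [set: sympair n * multiidx n])
    wedge (coframe (inr J)) (pd_form (inr J) w) c s.

Definition dtot (w : jform) : jform := dv w + dh w.

(* The graded commutator of the odd operators iprod and dtot. *)
Definition Lie (a : 'I_n) (w : jform) : jform :=
  iprod a (dtot w) + dtot (iprod a w).

(** * Metric objects *)

(* wedge is right-associated, ending with the constant 0-form 1. *)
Definition vol : jform :=
  fscale (fun c => Num.sqrt (- \det (gmat c)))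
    (\big[wedge/fun_form (fun=> 1)]_(a < n) dx a).

Definition g1 (a b e : 'I_n) (c : jetpt) : R := c (ig a b (mi_add (mi0 n) e)).

Definition christoffel (a b c : 'I_n) (x : jetpt) : R :=
  2^-1 * \sum_(d < n) invmx (gmat x) a d * (g1 d b c x + g1 d c b x - g1 b c d x).

Definition nabla (c : 'I_n) (chi : 'I_n -> 'I_n -> jform) (a b : 'I_n) : jform :=
  Lie c (chi a b) + \sum_(e < n) fscale (christoffel a c e) (chi e b)
                  + \sum_(e < n) fscale (christoffel b c e) (chi a e).

(** * Structure equations of the variational bicomplex *)

Lemma pd_cst k (r : R) c : pd k (fun=> r) c = 0.
Proof. by rewrite /pd derive1E derive_cst. Qed.

Lemma pd_coord k j c : pd k (fun x : jetpt => x j) c = (j == k)%:R.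
Proof.
rewrite /pd derive1E /upd; case: eqP => _; last by rewrite derive_cst.
by rewrite derive_id.
Qed.

Lemma total_deriv_cst e (r : R) c : total_deriv e (fun=> r) c = 0.
Proof.
rewrite /total_deriv pd_cst add0r fsbig1 // => J _.
by rewrite pd_cst mulr0.
Qed.

Lemma total_deriv_x e a c : total_deriv e (fun x : jetpt => x (ix a)) c = (a == e)%:R.
Proof.
rewrite /total_deriv pd_coord fsbig1 ?addr0 // => J _.
by rewrite pd_coord mulr0.
Qed.

Lemma fsum_single (T : choiceType) (F : T -> R) (t : T) :
  (forall u, u != t -> F u = 0) -> \sum_(u \in [set: T]) F u = F t.
Proof.
move=> F0; rewrite -(fsbig_widen [set t] setT) ?fsbig_set1 //.
by move=> u [_ /= /eqP/F0].
Qed.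

Lemma total_deriv_g e a b C c :
  total_deriv e (fun x : jetpt => x (ig a b C)) c = c (ig a b (mi_add C e)).
Proof.
rewrite /total_deriv pd_coord add0r (@fsum_single _ _ (spair a b, C)).
  by rewrite pd_coord eqxx mulr1.
move=> [J D] neq; rewrite pd_coord /ig.
case: eqP => [[eJ eD]|_]; last by rewrite mulr0.
by rewrite eJ eD eqxx in neq.
Qed.

Lemma wedge_at0l v s : wedge_at (fun=> 0) v s = 0.
Proof.
elim: s v => [|k s IHs] v /=; first by rewrite mul0r.
rewrite IHs add0r -[RHS](IHs (fun t => v (k :: t))); congr wedge_at.
by apply/funext => t; rewrite mulr0.
Qed.

Lemma wedge_at0r u s : wedge_at u (fun=> 0) s = 0.
Proof. by elim: s u => [|k s IHs] u /=; rewrite ?mulr0 // !IHs addr0. Qed.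

Lemma wedge_at_scalarl r v s :
  wedge_at (fun t => r * (t == [::])%:R) v s = r * v s.
Proof.
elim: s v => [|k s IHs] v /=; first by rewrite mulr1.
have -> : (fun t : seq (jetidx n) => r * (k :: t == [::])%:R) = fun=> 0.
  by apply/funext => t; rewrite mulr0.
rewrite wedge_at0l add0r -(IHs (fun t => v (k :: t))); congr wedge_at.
by apply/funext => -[|j t] /=; rewrite ?mulr0 ?expr0 ?mul1r.
Qed.

Lemma wedge_atNl u v s :
  wedge_at (fun t => - u t) v s = - wedge_at u v s.
Proof.
elim: s u v => [|i s IHs] u v /=; first by rewrite mulNr.
rewrite (IHs (fun t => u (i :: t))) opprD; congr (_ + _).
by rewrite -IHs; congr wedge_at; apply/funext => t; rewrite mulrN.
Qed.

Lemma wedge_at_coframe k v j s c :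
  wedge_at (coframe k c) v (j :: s) =
  (j == k)%:R * v s - wedge_at (coframe k c) (fun t => v (j :: t)) s.
Proof.
rewrite /=; congr (_ + _).
  rewrite -wedge_at_scalarl; congr wedge_at; apply/funext => t.
  by rewrite /coframe eqseq_cons -natrM mulnb.
have -> : (fun t => (-1) ^+ size t * coframe k c t) = fun t => - coframe k c t.
  apply/funext => t; rewrite /coframe; case: eqP => [->|_] /=.
    by rewrite expr1 mulN1r.
  by rewrite mulr0 oppr0.
exact: wedge_atNl.
Qed.

Lemma wedge_coframe_fun k f c s :
  wedge (coframe k) (fun_form f) c s = (s == [:: k])%:R * f c.
Proof.
rewrite /wedge; case: s => [|j s]; first by rewrite /= !mul0r.
rewrite wedge_at_coframe wedge_at0r subr0; case: s => [|i s] /=.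
  by rewrite eqseq_cons andbT.
by rewrite eqseq_cons andbF mul0r mulr0.
Qed.

Lemma total_deriv_fun_form e f :
  total_deriv_form e (fun_form f) = fun_form (total_deriv e f).
Proof.
apply/funext => c; apply/funext => s; rewrite /total_deriv_form.
have shift0 t : shift_at e (fun=> 0) t = 0.
  by elim: t => //= k t ->; rewrite addr0; case: lower.
case: s => [|k s] /=; first by rewrite addr0.
by rewrite total_deriv_cst shift0; case: lower; rewrite !addr0.
Qed.

Lemma dhE w c s :
  dh w c s = \sum_(e < n) wedge (dx e) (total_deriv_form e w) c s.
Proof. by rewrite /dh !fct_sumE. Qed.

Lemma dh_fun f c s :
  dh (fun_form f) c s = \sum_(e < n) (s == [:: ix e])%:R * total_deriv e f c.
Proof.
by rewrite dhE; apply: eq_bigr => e _; rewrite total_deriv_fun_form wedge_coframe_fun.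
Qed.

Lemma dv_fun f c s :
  dv (fun_form f) c s = \sum_(J \in [set: sympair n * multiidx n])
     (s == [:: inr J])%:R * pd (inr J) f c.
Proof.
apply: eq_fsbigr => J _.
rewrite -[RHS](wedge_coframe_fun (inr J) (pd (inr J) f)); congr (wedge _ _ c s).
apply/funext => x; apply/funext => -[|k t] //=.
by rewrite /pd_form /= pd_cst.
Qed.

Lemma dh_x a : dh (fun_form (fun x => x (ix a))) = dx a.
Proof.
apply/funext => c; apply/funext => s; rewrite dh_fun (bigD1 a) //= big1 ?addr0.
  by rewrite total_deriv_x eqxx mulr1.
by move=> e /negPf ne; rewrite total_deriv_x [a == e]eq_sym ne mulr0.
Qed.

Lemma dv_x a : dv (fun_form (fun x => x (ix a))) = 0.
Proof.
apply/funext => c; apply/funext => s; rewrite dv_fun fsbig1 // => J _.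
by rewrite pd_coord mulr0.
Qed.

Lemma dh_g a b C : dh (fun_form (fun x => x (ig a b C))) =
  \sum_(e < n) fscale (fun x => x (ig a b (mi_add C e))) (dx e).
Proof.
apply/funext => c; apply/funext => s; rewrite dh_fun !fct_sumE.
by apply: eq_bigr => e _; rewrite total_deriv_g mulrC.
Qed.

Lemma dv_g a b C : dv (fun_form (fun x => x (ig a b C))) = deltag a b C.
Proof.
apply/funext => c; apply/funext => s; rewrite dv_fun.
rewrite (@fsum_single _ _ (spair a b, C)); first by rewrite pd_coord eqxx mulr1.
move=> [J D] neq; rewrite pd_coord /ig.
case: (_ =P inr (J, D)) => [[eJ eD]|_]; last by rewrite mulr0.
by rewrite eJ eD eqxx in neq.
Qed.

Lemma total_deriv_coframe e k c s : total_deriv_form e (coframe k) c s =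
  if s is [:: j] then (lower e j == Some k)%:R else 0.
Proof.
rewrite /total_deriv_form total_deriv_cst add0r.
case: s => [//|j [|i s]] /=.
  rewrite addr0 /coframe; case: lower => [l|//]; rewrite eqseq_cons andbT.
  by congr (_%:R).
have shift0 t : shift_at e (fun t0 => coframe k c [:: j, i & t0]) t = 0.
  have -> : (fun t0 => coframe k c [:: j, i & t0]) = fun=> 0.
    by apply/funext => t0; rewrite /coframe eqseq_cons andbF.
  by elim: t => //= l t ->; rewrite addr0; case: lower.
rewrite shift0 /coframe.
by do 2![case: lower => [?|]]; rewrite ?eqseq_cons ?andbF ?addr0.
Qed.

Lemma lower_ig e j a b C :
  (lower e j == Some (ig a b C)) = (j == ig a b (mi_add C e)).
Proof.
case: j => [j|[ab D]] //=; rewrite /ig.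
case: ifPn => [D0|].
  apply/eqP/eqP => -[-> eD].
    rewrite -eD; congr (inr (_, _)); apply/ffunP => i; rewrite !ffunE subnK //.
    by case: eqP => [->|].
  rewrite eD; congr (Some (inr (_, _))).
  by apply/ffunP => i; rewrite !ffunE addnK.
rewrite -eqn0Ngt => /eqP D0; apply/esym/negbTE/eqP => -[_ eD].
by move: D0; rewrite eD ffunE eqxx addn1.
Qed.

Lemma dh_dx a : dh (dx a) = 0.
Proof.
apply/funext => c; apply/funext => s; rewrite dhE big1 // => e _.
rewrite /wedge; have -> : total_deriv_form e (dx a) c = fun=> 0.
  apply/funext => t; rewrite total_deriv_coframe; case: t => [|j [|]] //.
  by case: j => [j|[ab D]] //=; case: ifP.
exact: wedge_at0r.
Qed.

Lemma wedge_coframe2 k l c s :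
  wedge (coframe k) (coframe l) c s =
  (s == [:: k; l])%:R - (s == [:: l; k])%:R.
Proof.
rewrite /wedge; case: s => [|i s]; first by rewrite /= !mul0r subrr.
rewrite wedge_at_coframe.
have -> : (fun t => coframe l c (i :: t)) =
          fun_form (fun=> (i == l)%:R) c.
  by apply/funext => -[|j t]; rewrite /coframe eqseq_cons ?andbT ?andbF.
rewrite -/(wedge (coframe k) (fun_form (fun=> (i == l)%:R)) c s).
rewrite wedge_coframe_fun !eqseq_cons /coframe -!natrM !mulnb.
by rewrite [(s == [:: k]) && _]andbC.
Qed.

Lemma dh_deltag a b C : dh (deltag a b C) =
  - \sum_(e < n) wedge (deltag a b (mi_add C e)) (dx e).
Proof.
rewrite -sumrN; apply/funext => c; apply/funext => s.
rewrite dhE !fct_sumE; apply: eq_bigr => e _.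
transitivity (wedge (dx e) (deltag a b (mi_add C e)) c s); last first.
  apply: etrans (wedge_coframe2 (ix e) (ig a b (mi_add C e)) c s) _.
  by rewrite -opprB -(wedge_coframe2 (ig a b (mi_add C e)) (ix e) c s).
rewrite /wedge; congr wedge_at.
apply/funext => t; rewrite total_deriv_coframe /deltag /coframe.
case: t => [|j [|i t]]; rewrite ?eqseq_cons ?andbF ?andbT //.
by rewrite -lower_ig.
Qed.

Lemma dv_coframe k : dv (coframe k) = 0.
Proof.
apply/funext => c; apply/funext => s; rewrite /dv fsbig1 // => J _.
rewrite /wedge; have -> : pd_form (inr J) (coframe k) c = fun=> 0.
  by apply/funext => t; rewrite /pd_form pd_cst.
exact: wedge_at0r.
Qed.

Lemma dv_dx a : dv (dx a) = 0. Proof. exact: dv_coframe. Qed.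

Lemma dv_deltag a b C : dv (deltag a b C) = 0. Proof. exact: dv_coframe. Qed.

Lemma iprod_dx a b : iprod a (dx b) = fun_form (fun=> (a == b)%:R).
Proof.
apply/funext => c; apply/funext => -[|k s].
  by rewrite /iprod /iota_frame /dx /coframe eqseq_cons andbT.
by rewrite /iprod /iota_frame /dx /coframe eqseq_cons andbF.
Qed.

Lemma iprod_deltag a b e C : iprod a (deltag b e C) = 0.
Proof. by []. Qed.

End JetSpace.

Arguments vol R n : clear implicits.

(* Main.v *)
Require Import Defs.
From mathcomp Require Import all_boot all_order all_algebra.
From mathcomp Require Import all_classical all_reals all_analysis.
From mathcomp Require Import ring lra.
Import Order.TTheory GRing.Theory Num.Theory.
Import numFieldNormedType.Exports.
Local Open Scope classical_set_scope.
Local Open Scope ring_scope.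

(** The identity holds at each point of the domain, and both sides equal
    (D_a chi^{ab} + Gamma^e_{ea} chi^{ab}) /\ iota_b vol, where D_a is the total
    derivative acting on forms.

    On the left, the Lie derivative of a form of horizontal degree 0 along the
    lift of d/dx^a is D_a ([Lie_vertical]).  Of the two Christoffel terms, the
    first is the trace term, and the second vanishes since Gamma^b_{ae} is
    symmetric in a, e ([christoffelC]).

    On the right, dh = dx^e /\ D_e, and D_e is an even derivation
    ([total_deriv_form_wedge]) that multiplies vol and its contractions by
    Gamma^a_{ae} ([total_deriv_form_vol]).  The latter is the classical formula
    for the derivative of sqrt(- det g), from Jacobi's formula [deriv_det].
    Moving dx^e across a p-form gives the sign (-1)^p ([wedge_at_coframeCA]), and
    dx^e /\ iota_a iota_b vol = delta^e_a iota_b vol - delta^e_b iota_a vol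
    ([wedge_dx_iprod2_vol]), because dx^e /\ vol = 0.  The antisymmetry of chi
    turns these two terms into twice the same sum.

    Two analytic points support this computation.  The hypotheses on chi are
    identities on the set of jets of lorentzian metrics, and differentiating
    them requires this set to be open along the coordinate lines ([near_JLor]),
    which rests on the openness of the lorentzian signature
    ([near_lorentzian]).  The total derivative is a sum over infinitely many
    jet coordinates; its additivity and its Leibniz rule are obtained when all
    but finitely many terms vanish, as they do for functions of finite order
    ([is_form_diff_at]). *)

Set Implicit Arguments.
Unset Strict Implicit.
Unset Printing Implicit Defensive.

(** * The exterior algebra of the coframe *)

Section WedgeAlgebra.
Variables (R : realType) (n : nat).
Implicit Types (u v w : seq (jetidx n) -> R) (s t : seq (jetidx n)).

(** The sign (-1)^deg produced when a vector is contracted past [u]. *)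
Definition grade u : seq (jetidx n) -> R := fun t => (-1) ^+ size t * u t.

Lemma gradeK u : grade (grade u) = u.
Proof. by apply/funext => t; rewrite /grade mulrA -expr2 sqrr_sign mul1r. Qed.

Lemma grade_cons k u :
  (fun t => grade u (k :: t)) = (fun t => - grade (fun t' => u (k :: t')) t).
Proof. by apply/funext => t; rewrite /grade /= exprS mulN1r mulNr. Qed.

Lemma wedge_at_cons u v k s : wedge_at u v (k :: s) =
  wedge_at (fun t => u (k :: t)) v s + wedge_at (grade u) (fun t => v (k :: t)) s.
Proof. by []. Qed.

Lemma wedge_atDl u u' v s :
  wedge_at (fun t => u t + u' t) v s = wedge_at u v s + wedge_at u' v s.
Proof.
elim: s u u' v => [|k s IHs] u u' v; first by rewrite /= mulrDl.
rewrite !wedge_at_cons (IHs (fun t => u (k :: t))).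
have -> : grade (fun t => u t + u' t) = fun t => grade u t + grade u' t.
  by apply/funext => t; rewrite /grade mulrDr.
by rewrite IHs addrACA.
Qed.

Lemma wedge_atDr u v v' s :
  wedge_at u (fun t => v t + v' t) s = wedge_at u v s + wedge_at u v' s.
Proof.
elim: s u v v' => [|k s IHs] u v v'; first by rewrite /= mulrDr.
by rewrite !wedge_at_cons !IHs addrACA.
Qed.

Lemma wedge_atZl r u v s :
  wedge_at (fun t => r * u t) v s = r * wedge_at u v s.
Proof.
elim: s u v => [|k s IHs] u v; first by rewrite /= mulrA.
rewrite !wedge_at_cons (IHs (fun t => u (k :: t))).
have -> : grade (fun t => r * u t) = fun t => r * grade u t.
  by apply/funext => t; rewrite /grade mulrCA.
by rewrite IHs mulrDr.
Qed.

Lemma wedge_atZr r u v s :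
  wedge_at u (fun t => r * v t) s = r * wedge_at u v s.
Proof.
elim: s u v => [|k s IHs] u v; first by rewrite /= mulrCA.
by rewrite !wedge_at_cons !IHs mulrDr.
Qed.

Lemma wedge_atNr u v s : wedge_at u (fun t => - v t) s = - wedge_at u v s.
Proof.
rewrite -mulN1r -wedge_atZr; congr wedge_at.
by apply/funext => t; rewrite mulN1r.
Qed.

Lemma wedge_at_suml I (r : seq I) (F : I -> seq (jetidx n) -> R) v s :
  wedge_at (fun t => \sum_(i <- r) F i t) v s = \sum_(i <- r) wedge_at (F i) v s.
Proof.
elim: r => [|i r IHr].
  rewrite big_nil -[RHS](wedge_at0l v s); congr wedge_at.
  by apply/funext => t; rewrite big_nil.
rewrite big_cons -IHr -wedge_atDl; congr wedge_at.
by apply/funext => t; rewrite big_cons.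
Qed.

Lemma wedge_at_sumr I (r : seq I) u (F : I -> seq (jetidx n) -> R) s :
  wedge_at u (fun t => \sum_(i <- r) F i t) s = \sum_(i <- r) wedge_at u (F i) s.
Proof.
elim: r => [|i r IHr].
  rewrite big_nil -[RHS](wedge_at0r u s); congr wedge_at.
  by apply/funext => t; rewrite big_nil.
rewrite big_cons -IHr -wedge_atDr; congr wedge_at.
by apply/funext => t; rewrite big_cons.
Qed.

(** A coframe element a is odd, so a /\ (u /\ v) = grade u /\ (a /\ v).  This one
    identity replaces associativity and graded commutativity of the wedge
    product: with [u] itself a coframe element it gives anticommutation, and
    with [u] of degree p it moves dx^e across [u].  The induction contracts both
    sides with the first vector of the list. *)
Lemma wedge_at_coframeCA k c u v s :
  wedge_at (coframe k c) (wedge_at u v) s =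
  wedge_at (grade u) (wedge_at (coframe k c) v) s.
Proof.
elim: s u v => [|j s IHs] u v; first by rewrite /= mul0r mul0r mulr0.
rewrite wedge_at_coframe.
have -> : (fun t => wedge_at u v (j :: t)) = (fun t =>
    wedge_at (fun t => u (j :: t)) v t + wedge_at (grade u) (fun t => v (j :: t)) t).
  by [].
rewrite wedge_atDr !IHs gradeK wedge_at_cons gradeK grade_cons wedge_atNl.
have -> : (fun t => wedge_at (coframe k c) v (j :: t)) = (fun t =>
    (j == k)%:R * v t + - wedge_at (coframe k c) (fun t => v (j :: t)) t).
  by apply/funext => t; rewrite wedge_at_coframe.
by rewrite wedge_atDr wedge_atZr wedge_atNr; ring.
Qed.

Lemma grade_homog p u : (forall t, u t != 0 -> size t = p) ->
  grade u = fun t => (-1) ^+ p * u t.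
Proof.
move=> hu; apply/funext => t; rewrite /grade.
by have [->|/hu ->//] := eqVneq (u t) 0; rewrite !mulr0.
Qed.

Lemma wedge_at_coframe_anti k l c v s :
  wedge_at (coframe k c) (wedge_at (coframe l c) v) s =
  - wedge_at (coframe l c) (wedge_at (coframe k c) v) s.
Proof.
rewrite wedge_at_coframeCA (@grade_homog 1) ?expr1 ?wedge_atZl ?mulN1r //.
by move=> t; rewrite /coframe; case: (t =P _) => [-> //|_]; rewrite eqxx.
Qed.

Lemma wedge_at_coframe_sq k c v s :
  wedge_at (coframe k c) (wedge_at (coframe k c) v) s = 0.
Proof.
have /eqP := wedge_at_coframe_anti k k c v s.
by rewrite -addr_eq0 -mulr2n mulrn_eq0 => /eqP.
Qed.

Lemma shift_at0 e s : shift_at e (fun=> 0 : R) s = 0.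
Proof. by elim: s => //= k s ->; rewrite addr0; case: lower. Qed.

Lemma shift_atD e u v s :
  shift_at e (fun t => u t + v t) s = shift_at e u s + shift_at e v s.
Proof.
elim: s u v => [|k s IHs] u v /=; first by rewrite addr0.
by rewrite IHs addrACA; case: lower => [l|] //; rewrite addr0.
Qed.

Lemma shift_atZ e r u s :
  shift_at e (fun t => r * u t) s = r * shift_at e u s.
Proof.
elim: s u => [|k s IHs] u /=; first by rewrite mulr0.
by rewrite IHs mulrDr; case: lower => [l|] //; rewrite mulr0.
Qed.

Lemma shift_at_sum I (r : seq I) e (F : I -> seq (jetidx n) -> R) s :
  shift_at e (fun t => \sum_(i <- r) F i t) s = \sum_(i <- r) shift_at e (F i) s.
Proof.
elim: r => [|i r IHr].
  rewrite big_nil -[RHS](shift_at0 e s); congr shift_at.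
  by apply/funext => t; rewrite big_nil.
rewrite big_cons -IHr -shift_atD; congr shift_at.
by apply/funext => t; rewrite big_cons.
Qed.

(** [shift_at] substitutes entries without changing the length, so it respects
    the degree of a form. *)
Lemma shift_at_eq_size p e u s : (forall t, size t = p -> u t = 0) ->
  size s = p -> shift_at e u s = 0.
Proof.
elim: s p u => [//|k s IHs] [//|p] u u0 [sp] /=.
rewrite (IHs p) ?addr0 //; last by move=> t tp; rewrite u0 //= tp.
by case: lower => // l; rewrite u0 //= sp.
Qed.

Lemma shift_at_grade e u s : shift_at e (grade u) s = grade (shift_at e u) s.
Proof.
rewrite [RHS]/grade -shift_atZ; apply: subr0_eq.
rewrite -[X in _ + X]mulN1r -shift_atZ -shift_atD.
apply: (@shift_at_eq_size (size s)) => // t ts.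
by rewrite /grade ts mulN1r subrr.
Qed.

(** [shift_at] is an even derivation of the exterior algebra: at each entry of
    the list, the substitution falls either on an argument of [u] or on an
    argument of [v]. *)
Lemma shift_at_wedge e u v s : shift_at e (wedge_at u v) s =
  wedge_at (shift_at e u) v s + wedge_at u (shift_at e v) s.
Proof.
elim: s u v => [|k s IHs] u v; first by rewrite /= mul0r mulr0 addr0.
rewrite [LHS]/= -/(wedge_at _ _).
rewrite -[X in shift_at _ X]/(fun t => wedge_at (fun t' => u (k :: t')) v t
  + wedge_at (grade u) (fun t' => v (k :: t')) t).
rewrite shift_atD !IHs !wedge_at_cons.
have -> : (fun t => shift_at e u (k :: t)) = (fun t =>
   (if lower e k is Some k' then u (k' :: t) else 0) + shift_at e (fun t' => u (k :: t')) t).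
  by [].
have -> : (fun t => shift_at e v (k :: t)) = (fun t =>
   (if lower e k is Some k' then v (k' :: t) else 0) + shift_at e (fun t' => v (k :: t')) t).
  by [].
have -> : shift_at e (grade u) = grade (shift_at e u).
  by apply/funext => t; exact: shift_at_grade.
rewrite wedge_atDl wedge_atDr.
case: lower => [l|]; last by rewrite wedge_at0l wedge_at0r; ring.
by rewrite /= -/(grade u); ring.
Qed.

(** Forms built from the dx^a only. *)
Definition horizontal u := forall s, has (@is_vert n) s -> u s = 0.

(** The derivation takes dx^b to 0: its value on a list is a sum of values at
    lists that contain a vertical vector. *)
Lemma shift_at_horizontal e u s : horizontal u -> shift_at e u s = 0.
Proof.
elim: s u => [//|k s IHs] u hu /=.
rewrite IHs ?addr0 => [|t ht]; last by rewrite hu //= ht orbT.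
by case: k => [//|[ab C]] /=; case: ifP => // _; rewrite hu.
Qed.

Lemma wedge_at_dx_horizontal a c u :
  horizontal u -> horizontal (wedge_at (dx a c) u).
Proof.
move=> hu s; elim: s u hu => [//|j s IHs] u hu.
rewrite wedge_at_coframe; case: j => [b|J] /= hs.
  rewrite (hu s hs) mulr0 IHs ?subr0 //.
  by move=> t ht; rewrite hu.
rewrite mul0r sub0r.
have -> : (fun t => u (inr J :: t)) = fun=> 0.
  by apply/funext => t; rewrite hu.
by rewrite wedge_at0r oppr0.
Qed.

End WedgeAlgebra.

(** * Determinants and the lorentzian signature *)

Section Metrics.
Variable R : realType.

Lemma deriv_prod (I : eqType) (r : seq I) (F : I -> {poly R}) : uniq r ->
  (\prod_(i <- r) F i)^`() =
  \sum_(i <- r) \prod_(j <- r) (if j == i then (F j)^`() else F j).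
Proof.
elim: r => [|i r IHr] /=; first by rewrite !big_nil derivC.
move=> /andP[ir ur]; rewrite !big_cons derivM IHr //; congr (_ + _).
  rewrite eqxx; congr (_ * _); rewrite !big_seq; apply: eq_bigr => j jr.
  by case: eqP => // ji; rewrite ji (negPf ir) in jr.
rewrite big_distrr /= big_seq [RHS]big_seq; apply: eq_bigr => j jr.
rewrite big_cons; case: eqP => // ij.
by rewrite -ij (negPf ir) in jr.
Qed.

(** Jacobi's formula.  Differentiating the Leibniz expansion row by row gives
    determinants with one row differentiated; expanding each along that row
    only sees cofactors of the original matrix. *)
Lemma deriv_det n (M : 'M[{poly R}]_n) :
  (\det M)^`() = \sum_i \sum_j (M i j)^`() * cofactor M i j.
Proof.
pose N i := \matrix_(j, k) if j == i then (M j k)^`() else M j k.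
transitivity (\sum_i \det (N i)); last first.
  apply: eq_bigr => i _; rewrite (expand_det_row _ i); apply: eq_bigr => j _.
  rewrite mxE eqxx; congr (_ * (_ * \det _)).
  by apply/matrixP => k l; rewrite !mxE eq_sym (negPf (neq_lift _ _)).
rewrite /determinant linear_sum exchange_big; apply: eq_bigr => s _ /=.
rewrite derivM -[in X in X^`() * _]polyC1 -polyCN -polyC_exp derivC mul0r add0r.
rewrite deriv_prod ?index_enum_uniq // big_distrr; apply: eq_bigr => i _.
by congr (_ * _); apply: eq_bigr => j _; rewrite mxE.
Qed.

(** Along a line of matrices the determinant is a polynomial in the parameter;
    this yields its derivative and its continuity together. *)
Lemma det_affine n (A E : 'M[R]_n) (t0 : R) : exists2 p : {poly R},
  forall t, \det (A + (t - t0) *: E) = p.[t] &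
  p^`().[t0] = \sum_i \sum_j E i j * cofactor A i j.
Proof.
pose M : 'M[{poly R}]_n := \matrix_(i, j) ((A i j)%:P + ('X - t0%:P) * (E i j)%:P).
have mapM t : map_mx (horner_eval t) M = A + (t - t0) *: E.
  by apply/matrixP => i j; rewrite !mxE /horner_eval !hornerE.
exists (\det M) => [t|].
  by rewrite -mapM det_map_mx.
rewrite deriv_det -/(horner_eval t0 _) rmorph_sum; apply: eq_bigr => i _.
rewrite rmorph_sum; apply: eq_bigr => j _; rewrite rmorphM /= -cofactor_map_mx.
rewrite mapM subrr scale0r addr0; congr (_ * _).
by rewrite mxE /horner_eval derivD derivM derivXsubC !derivC !hornerE.
Qed.

Lemma is_derive_det n (A E : 'M[R]_n) (t0 : R) :
  is_derive t0 (1 : R) (fun t : R => \det (A + (t - t0) *: E))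
    (\sum_i \sum_j E i j * cofactor A i j).
Proof.
have [p pE <-] := det_affine A E t0.
have -> : (fun t => \det (A + (t - t0) *: E)) = horner p by apply/funext.
exact: is_derive_poly.
Qed.

Lemma continuous_det n (A E : 'M[R]_n) (t0 : R) :
  continuous (fun t : R => \det (A + (t - t0) *: E)).
Proof.
have [p pE _] := det_affine A E t0.
have -> : (fun t => \det (A + (t - t0) *: E)) = horner p by apply/funext.
exact: continuous_horner.
Qed.

(** Both sides are the determinant of the block matrix with blocks 1, -B, C, 1,
    computed by the two Schur complements; the proof compares two
    block-triangular factorizations. *)
Lemma det_1Dmul m n (B : 'M[R]_(m, n)) (C : 'M[R]_(n, m)) :
  \det (1%:M + B *m C) = \det (1%:M + C *m B).
Proof.
have : block_mx 1%:M 0 C 1%:M *m block_mx (1%:M + B *m C) B 0 1%:M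
     = block_mx 1%:M B 0 (1%:M + C *m B) *m block_mx 1%:M 0 C 1%:M.
  rewrite !mulmx_block !(mul1mx, mulmx1, mul0mx, mulmx0, add0r, addr0).
  by congr block_mx; rewrite ?mulmxDl ?mulmxDr ?mul1mx ?mulmx1 ?mulmxA // addrC.
move/(congr1 determinant); rewrite !det_mulmx !det_ublock !det_lblock !det1.
by rewrite !mul1r !mulr1.
Qed.

Lemma det_lorentzian n (g : 'M[R]_n) : lorentzian g -> \det g < 0.
Proof.
move=> [i0 [P [uP ->]]]; rewrite !det_mulmx det_tr det_diag.
rewrite (bigD1 i0) //= mxE eqxx big1 ?mulr1 => [|i ni]; last by rewrite mxE (negPf ni).
rewrite mulrN1 mulNr oppr_lt0 -expr2 exprn_even_gt0 //=.
by move: uP; rewrite unitmxE unitfE.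
Qed.

Lemma lorentzian_congr n (g P : 'M[R]_n) :
  P \in unitmx -> lorentzian g -> lorentzian (P^T *m g *m P).
Proof.
move=> uP [i0 [Q [uQ ->]]]; exists i0, (Q *m P); split.
  by rewrite unitmx_mul uQ.
by rewrite trmx_mul !mulmxA.
Qed.

Lemma lorentzian_sym n (g : 'M[R]_n) : lorentzian g -> g^T = g.
Proof.
by move=> [i0 [P [_ ->]]]; rewrite !trmx_mul trmxK tr_diag_mx mulmxA.
Qed.

(** A rank-one perturbation of a lorentzian matrix is lorentzian as soon as its
    determinant stays negative.  With v = w g^-1 and q = v w^T, the determinant
    of the perturbed matrix is (1 + r q) det g, so that 1 + r q > 0, and then
    g + r w^T w = P^T g P for P = 1 + a v^T w, where a solves
    2 a + a^2 q = r. *)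
Lemma lorentzian_rank1 n (g : 'M[R]_n) (w : 'rV_n) (r : R) : lorentzian g ->
  \det (g + r *: (w^T *m w)) < 0 -> lorentzian (g + r *: (w^T *m w)).
Proof.
move=> Lg det_lt0; have dg := det_lorentzian Lg; have sg := lorentzian_sym Lg.
have ug : g \in unitmx by rewrite unitmxE unitfE lt_eqF.
pose v := w *m invmx g.
have vg : v *m g = w by rewrite mulmxKV.
have gv : g *m v^T = w^T by rewrite -[in LHS]sg -trmx_mul vg.
pose q := (v *m w^T) 0 0.
have vwE : v *m w^T = q%:M by rewrite [LHS]mx11_scalar.
have wvE : w *m v^T = q%:M by rewrite -[LHS]trmxK trmx_mul trmxK vwE tr_scalar_mx.
have det1 (x : R) : \det (1%:M + x *: (v^T *m w)) = 1 + x * q.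
  rewrite scalemxAl det_1Dmul -scalemxAr wvE.
  by rewrite det_mx11 !mxE.
have q_gt : 0 < 1 + r * q.
  move: det_lt0; have -> : g + r *: (w^T *m w) = g *m (1%:M + r *: (v^T *m w)).
    by rewrite mulmxDr mulmx1 -scalemxAr mulmxA gv.
  by rewrite det_mulmx det1 nmulr_rlt0.
set S := Num.sqrt (1 + r * q).
have S2 : S ^+ 2 = 1 + r * q by rewrite sqr_sqrtr // ltW.
have S1 : 1 + S != 0 by rewrite gt_eqF // addr_gt0 // sqrtr_gt0.
(* The root (S - 1) / q of a^2 q + 2 a = r, rationalized so that q = 0 is
   covered. *)
pose a := r / (1 + S).
have aq : 1 + a * q = S.
  apply: (mulfI S1); rewrite /a mulrDr mulrA mulrCA divff // mulr1 mulr1.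
  by rewrite -addrA [S + _]addrC addrA -S2; ring.
have ar : a * 2 + a ^+ 2 * q = r.
  have -> : a * 2 + a ^+ 2 * q = a * (1 + (1 + a * q)) by ring.
  by rewrite aq /a divfK.
pose P := 1%:M + a *: (v^T *m w).
have uP : P \in unitmx.
  by rewrite unitmxE unitfE det1 aq gt_eqF // sqrtr_gt0.
have -> : g + r *: (w^T *m w) = P^T *m g *m P; last exact: lorentzian_congr.
have -> : P^T = 1%:M + a *: (w^T *m v).
  by rewrite /P linearD linearZ /= trmx1 trmx_mul trmxK.
rewrite /P mulmxDl mul1mx -scalemxAl -[w^T *m v *m g]mulmxA vg.
rewrite mulmxDl !mulmxDr !mulmx1 -!scalemxAr -scalemxAl mulmxA gv.
rewrite -[w^T *m w *m _]mulmxA [w *m _]mulmxA wvE mul_scalar_mx -scalemxAr.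
by rewrite !scalerA -!addrA -!scalerDl -ar; congr (_ + _ *: _); ring.
Qed.

(** Polarization of the entries of a symmetric matrix. *)
Lemma sum_rank1_sym n (E : 'M[R]_n) : E^T = E ->
  E = \sum_(ij : 'I_n * 'I_n)
    let e k := delta_mx 0 k : 'rV[R]_n in
    let wp := e ij.1 + e ij.2 in let wm := e ij.1 - e ij.2 in
    (E ij.1 ij.2 / 4) *: (wp^T *m wp) + (- (E ij.1 ij.2 / 4)) *: (wm^T *m wm).
Proof.
move=> sE.
transitivity (\sum_i \sum_j (E i j / 2) *: (delta_mx i j + delta_mx j i)).
  rewrite {1}[E]matrix_sum_delta -[LHS]/(\sum_i (\sum_j E i j *: delta_mx i j)).
  transitivity (\sum_i \sum_j (E i j / 2) *: delta_mx i j +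
                \sum_i \sum_j (E i j / 2) *: delta_mx j i).
    rewrite [X in _ = _ + X]exchange_big -big_split; apply: eq_bigr => i _ /=.
    rewrite -big_split; apply: eq_bigr => j _ /=.
    have -> : E j i = E i j by rewrite -{1}sE mxE.
    by rewrite -scalerDl; congr (_ *: _); lra.
  rewrite -big_split; apply: eq_bigr => i _ /=; rewrite -big_split.
  by apply: eq_bigr => j _ /=; rewrite scalerDr.
rewrite pair_bigA; apply: eq_bigr => -[i j] _ /=.
apply/matrixP => k l; rewrite !mxE !big_ord1 !mxE !eqxx /=.
by case: (k == i); case: (l == j); case: (k == j); case: (l == i) => /=; field.
Qed.

(** Openness of the signature along lines: perturb by the rank-one summands of
    [E] one after the other.  After each of them the determinant remains
    negative for [t] near [t0], by continuity, so [lorentzian_rank1] applies. *)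
Lemma near_lorentzian n (g E : 'M[R]_n) (t0 : R) : lorentzian g -> E^T = E ->
  \forall t \near t0, lorentzian (g + (t - t0) *: E).
Proof.
move=> Lg /sum_rank1_sym ->.
have step (F : 'M[R]_n) (w : 'rV_n) (r : R) :
    (\forall t \near t0, lorentzian (g + (t - t0) *: F)) ->
    \forall t \near t0, lorentzian (g + (t - t0) *: (r *: (w^T *m w) + F)).
  move=> LF; set F' := _ + F.
  have : \forall t \near t0, \det (g + (t - t0) *: F') < 0.
    have := @cvgr_lt _ _ _ _ _ _ (@continuous_det n g F' t0 t0); apply.
    by rewrite subrr scale0r addr0 det_lorentzian.
  apply: filterS2 LF => t Lt; rewrite scalerDr addrCA addrC scalerA.
  exact: lorentzian_rank1.
elim/big_rec: _ => [|ij F _ LF].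
  by apply: filterE => t; rewrite scaler0 addr0.
rewrite /= -addrA.
pose e k : 'rV[R]_n := delta_mx 0 k.
exact (step _ (e ij.1 + e ij.2) _ (step F (e ij.1 - e ij.2) _ LF)).
Qed.

End Metrics.

(** * Total derivatives as derivations *)

Section FiniteSupportSums.
Variables (R : idomainType) (T : choiceType).
Implicit Types F G : T -> R.

Lemma fsum_restrict (A : set T) F : [set x | F x != 0] `<=` A ->
  \sum_(x \in [set: T]) F x = \sum_(x \in A) F x.
Proof.
move=> FA; apply/esym/fsbig_widen => // x [_ /= Ax].
by apply: contra_notP Ax => /eqP /FA.
Qed.

Lemma fsumD F G : finite_set [set x | F x != 0] -> finite_set [set x | G x != 0] ->
  \sum_(x \in [set: T]) (F x + G x) =
  \sum_(x \in [set: T]) F x + \sum_(x \in [set: T]) G x.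
Proof.
move=> fF fG; pose A := [set x | F x != 0] `|` [set x | G x != 0].
have fA : finite_set A by rewrite finite_setU.
rewrite !(@fsum_restrict A) ?fsbig_split //.
- by move=> x; right.
- by move=> x; left.
- move=> x /= FG; apply: contrapT => /not_orP[/negP/negPn/eqP F0 /negP/negPn/eqP G0].
  by rewrite F0 G0 addr0 eqxx in FG.
Qed.

Lemma fsum_sum (I : Type) (r : seq I) (F : I -> T -> R) :
  (forall i, finite_set [set x | F i x != 0]) ->
  \sum_(x \in [set: T]) (\sum_(i <- r) F i x) =
  \sum_(i <- r) \sum_(x \in [set: T]) F i x.
Proof.
move=> fF; suff [] : finite_set [set x | \sum_(i <- r) F i x != 0] /\
  \sum_(x \in [set: T]) (\sum_(i <- r) F i x) =
  \sum_(i <- r) \sum_(x \in [set: T]) F i x by [].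
elim: r => [|i r [fr IHr]].
  rewrite big_nil; split; last by apply: fsbig1 => x _; rewrite big_nil.
  by rewrite (_ : mkset _ = set0) //; apply/seteqP; split=> x //=; rewrite big_nil eqxx.
split; last first.
  by rewrite big_cons -IHr -fsumD //; apply: eq_fsbigr => x _; rewrite big_cons.
apply: (sub_finite_set (B := [set x | F i x != 0] `|` [set x | \sum_(i <- r) F i x != 0])).
  move=> x /=; rewrite big_cons => FG; apply: contrapT.
  move=> /not_orP[/negP/negPn/eqP F0 /negP/negPn/eqP G0].
  by rewrite F0 G0 addr0 eqxx in FG.
by rewrite finite_setU.
Qed.

End FiniteSupportSums.

Section TotalDerivative.
Variables (R : realType) (n : nat).
Implicit Types (c : jetpt R n) (f h : jetpt R n -> R) (k : jetidx n).

Lemma upd_id c k : upd c k (c k) = c.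
Proof. by apply/funext => j; rewrite /upd; case: eqP => [->|]. Qed.

(** The condition at [c] under which the total derivatives are additive and obey
    the Leibniz rule.  Finiteness is essential: the sum over the jet coordinates
    in [total_deriv] takes the value 0 when its support is infinite. *)
Definition diff_at c f : Prop :=
  (forall k, derivable (fun t : R => f (upd c k t) : R) (c k) 1) /\
  finite_set [set J | pd (inr J) f c != 0].

Lemma pd_near f h c k :
  (\forall t \near c k, f (upd c k t) = h (upd c k t)) -> pd k f c = pd k h c.
Proof. by move=> fh; rewrite /pd !derive1E; apply: near_eq_derive. Qed.

Lemma is_derive_pd c f k : derivable (fun t : R => f (upd c k t) : R) (c k) 1 ->
  is_derive (c k) (1 : R) (fun t : R => f (upd c k t) : R) (pd k f c).
Proof. by move=> df; apply: DeriveDef => //; rewrite /pd derive1E. Qed.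

Lemma pd_is_derive c f k (r : R) :
  is_derive (c k) (1 : R) (fun t : R => f (upd c k t) : R) r -> pd k f c = r.
Proof. by move=> [_ <-]; rewrite /pd derive1E. Qed.

Lemma pdD c f h k : diff_at c f -> diff_at c h ->
  pd k (fun x => f x + h x) c = pd k f c + pd k h c.
Proof.
move=> [df _] [dh _]; apply: pd_is_derive.
exact: (is_deriveD (is_derive_pd (df k)) (is_derive_pd (dh k))).
Qed.

Lemma pdM c f h k : diff_at c f -> diff_at c h ->
  pd k (fun x => f x * h x) c = pd k f c * h c + f c * pd k h c.
Proof.
move=> [df _] [dh _]; apply: pd_is_derive.
have := is_deriveM (is_derive_pd (df k)) (is_derive_pd (dh k)).
rewrite !upd_id /GRing.scale /= => d; apply: is_derive_eq d _.
by rewrite addrC mulrC.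
Qed.

Lemma finite_support_pdD c f h (F : _ -> R) : diff_at c f -> diff_at c h ->
  (forall J, pd (inr J) f c = 0 -> pd (inr J) h c = 0 -> F J = 0) ->
  finite_set [set J | F J != 0].
Proof.
move=> [_ ff] [_ fh] F0.
apply: (@sub_finite_set _ _ ([set J | pd (inr J) f c != 0] `|` [set J | pd (inr J) h c != 0])).
  move=> J /= FJ; apply: contrapT => /not_orP[/negP/negPn/eqP f0 /negP/negPn/eqP h0].
  by rewrite F0 ?eqxx in FJ.
by rewrite finite_setU.
Qed.

Lemma diff_atD c f h : diff_at c f -> diff_at c h ->
  diff_at c (fun x => f x + h x).
Proof.
move=> Hf Hh; split=> [k|]; first exact: derivableD (Hf.1 k) (Hh.1 k).
by apply: (finite_support_pdD Hf Hh) => J f0 h0; rewrite pdD // f0 h0 addr0.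
Qed.

Lemma diff_atM c f h : diff_at c f -> diff_at c h ->
  diff_at c (fun x => f x * h x).
Proof.
move=> Hf Hh; split=> [k|]; first exact: derivableM (Hf.1 k) (Hh.1 k).
by apply: (finite_support_pdD Hf Hh) => J f0 h0; rewrite pdM // f0 h0 mul0r mulr0 addr0.
Qed.

Lemma diff_at_cst c (r : R) : diff_at c (fun=> r).
Proof.
split=> [k|]; first exact: derivable_cst.
rewrite (_ : mkset _ = set0) //; apply/seteqP; split=> J //=.
by rewrite pd_cst eqxx.
Qed.

Lemma diff_at_sum c I (r : seq I) (F : I -> jetpt R n -> R) :
  (forall i, diff_at c (F i)) -> diff_at c (fun x => \sum_(i <- r) F i x).
Proof.
move=> HF; elim: r => [|i r IHr].
  have -> : (fun x => \sum_(i <- [::]) F i x) = fun=> 0.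
    by apply/funext => x; rewrite big_nil.
  exact: diff_at_cst.
have -> : (fun x => \sum_(j <- i :: r) F j x) = fun x => F i x + \sum_(j <- r) F j x.
  by apply/funext => x; rewrite big_cons.
exact: diff_atD.
Qed.

Lemma total_derivD e c f h : diff_at c f -> diff_at c h ->
  total_deriv e (fun x => f x + h x) c = total_deriv e f c + total_deriv e h c.
Proof.
move=> Hf Hh; rewrite /total_deriv pdD // addrACA; congr (_ + _).
rewrite -fsumD; first by apply: eq_fsbigr => J _; rewrite pdD // mulrDr.
- by apply: (finite_support_pdD Hf Hh) => J f0 _; rewrite f0 mulr0.
- by apply: (finite_support_pdD Hf Hh) => J _ h0; rewrite h0 mulr0.
Qed.

Lemma total_derivM e c f h : diff_at c f -> diff_at c h ->
  total_deriv e (fun x => f x * h x) c =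
  total_deriv e f c * h c + f c * total_deriv e h c.
Proof.
move=> Hf Hh; rewrite /total_deriv pdM // mulrDl mulrDr addrACA; congr (_ + _).
rewrite mulr_fsuml mulr_fsumr -fsumD.
- by apply: eq_fsbigr => J _; rewrite pdM // mulrDr mulrA mulrCA.
- by apply: (finite_support_pdD Hf Hh) => J f0 _; rewrite f0 mulr0 mul0r.
- by apply: (finite_support_pdD Hf Hh) => J _ h0; rewrite h0 !mulr0.
Qed.

Lemma total_derivZ e c r f : diff_at c f ->
  total_deriv e (fun x => r * f x) c = r * total_deriv e f c.
Proof.
move=> Hf; rewrite total_derivM //; last exact: diff_at_cst.
by rewrite total_deriv_cst mul0r add0r.
Qed.

Lemma total_deriv_sum e c I (r : seq I) (F : I -> jetpt R n -> R) :
  (forall i, diff_at c (F i)) ->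
  total_deriv e (fun x => \sum_(i <- r) F i x) c = \sum_(i <- r) total_deriv e (F i) c.
Proof.
move=> HF; elim: r => [|i r IHr].
  have -> : (fun x => \sum_(i <- [::]) F i x) = fun=> 0.
    by apply/funext => x; rewrite big_nil.
  by rewrite big_nil total_deriv_cst.
have -> : (fun x => \sum_(j <- i :: r) F j x) = fun x => F i x + \sum_(j <- r) F j x.
  by apply/funext => x; rewrite big_cons.
by rewrite big_cons -IHr total_derivD //; exact: diff_at_sum.
Qed.

Lemma wedge_consE (u v : jform R n) k s :
  (fun x => wedge u v x (k :: s)) = (fun x => wedge (iota_frame k u) v x s +
    wedge (fun y => grade (u y)) (iota_frame k v) x s).
Proof. by []. Qed.

Lemma diff_at_wedge c (u v : jform R n) s :
  (forall t, diff_at c (fun x => u x t)) -> (forall t, diff_at c (fun x => v x t)) ->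
  diff_at c (fun x => wedge u v x s).
Proof.
elim: s u v => [|k s IHs] u v Hu Hv; first exact: diff_atM.
rewrite wedge_consE; apply: diff_atD.
  by apply: IHs => t; [exact: Hu | exact: Hv].
apply: IHs => t; last exact: Hv.
by apply: diff_atM (Hu t); exact: diff_at_cst.
Qed.

Lemma total_deriv_wedge e c (u v : jform R n) s :
  (forall t, diff_at c (fun x => u x t)) -> (forall t, diff_at c (fun x => v x t)) ->
  total_deriv e (fun x => wedge u v x s) c =
  wedge_at (fun t => total_deriv e (fun x => u x t) c) (v c) s +
  wedge_at (u c) (fun t => total_deriv e (fun x => v x t) c) s.
Proof.
elim: s u v => [|k s IHs] u v Hu Hv; first exact: total_derivM.
have Hgu t : diff_at c (fun x => grade (u x) t).
  by apply: diff_atM (Hu t); exact: diff_at_cst.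
have Hu' t : diff_at c (fun x => iota_frame k u x t) by exact: Hu.
have Hv' t : diff_at c (fun x => iota_frame k v x t) by exact: Hv.
rewrite wedge_consE (total_derivD _ (diff_at_wedge s Hu' Hv) (diff_at_wedge s Hgu Hv')).
rewrite (IHs _ _ Hu' Hv) (IHs _ _ Hgu Hv') !wedge_at_cons addrACA.
congr (_ + wedge_at _ _ _ + _).
by apply/funext => t; rewrite total_derivZ.
Qed.

(** The total derivative of forms is an even derivation, because it is one on
    the coefficients ([total_deriv_wedge]) and on the coframe
    ([shift_at_wedge]). *)
Lemma total_deriv_form_wedge e c (u v : jform R n) s :
  (forall t, diff_at c (fun x => u x t)) -> (forall t, diff_at c (fun x => v x t)) ->
  total_deriv_form e (wedge u v) c s =
  wedge_at (total_deriv_form e u c) (v c) s + wedge_at (u c) (total_deriv_form e v c) s.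
Proof.
move=> Hu Hv; rewrite {1}/total_deriv_form total_deriv_wedge // /wedge.
rewrite shift_at_wedge addrACA -wedge_atDl -wedge_atDr //.
Qed.

End TotalDerivative.

(** * The jets of lorentzian metrics and the volume form *)

Section JetOfMetrics.
Variables (R : realType) (n : nat).
Implicit Types (c : jetpt R n) (k : jetidx n) (U : set 'rV[R]_n).

Lemma spairC (a b : 'I_n) : spair a b = spair b a.
Proof.
apply/val_inj => /=; case: ltngtP => //= ab.
by congr (_, _); apply/val_inj; rewrite /= ab.
Qed.

Lemma igC (a b : 'I_n) C : ig a b C = ig b a C.
Proof. by rewrite /ig spairC. Qed.

Lemma spair_surj (ab : sympair n) : exists i j, ab = spair i j.
Proof.
exists (val ab).1, (val ab).2; apply/val_inj => /=.
by case: ab => -[i j] /= ->.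
Qed.

Lemma gmat_sym c : (gmat c)^T = gmat c.
Proof. by apply/matrixP => i j; rewrite !mxE igC. Qed.

(** The velocity of the metric along the coordinate [k]; it has two nonzero
    entries when [k] is an off-diagonal component. *)
Definition metric_dir k : 'M[R]_n := \matrix_(a, b) (ig a b (mi0 n) == k)%:R.

Lemma gmat_upd c k t : gmat (upd c k t) = gmat c + (t - c k) *: metric_dir k.
Proof.
apply/matrixP => a b; rewrite !mxE /upd; case: eqP => [<-|_].
  by rewrite mulr1 addrC subrK.
by rewrite mulr0 addr0.
Qed.

Lemma base_upd c k t :
  base (upd c k t) = base c + (t - c k) *: \row_a (ix a == k)%:R.
Proof.
apply/matrixP => a b; rewrite !mxE /upd; case: eqP => [<-|_].
  by rewrite mulr1 addrC subrK.
by rewrite mulr0 addr0.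
Qed.

(** Partial derivatives at a point of the domain only see the domain: this is
    what turns hypotheses on [JLor U] into identities between derivatives. *)
Lemma near_JLor U c k : open U -> JLor U c ->
  \forall t \near c k, JLor U (upd c k t).
Proof.
move=> oU [Uc Lc].
have : \forall t \near c k, lorentzian (gmat c + (t - c k) *: metric_dir k).
  apply: near_lorentzian => //; apply/matrixP => i j.
  by rewrite !mxE igC.
have : \forall t \near c k, U (base c + (t - c k) *: \row_a (ix a == k)%:R).
  set v := \row_a _.
  have : (fun t : R => base c + (t - c k) *: v) @ c k --> base c + (c k - c k) *: v.
    apply: cvgD; first exact: cvg_cst.
    by apply: cvgZl; apply: cvgB; [exact: cvg_id | exact: cvg_cst].
  by rewrite subrr scale0r addr0; apply; exact: open_nbhs_nbhs.
by apply: filterS2 => t Ut Lt; split; rewrite /= ?base_upd ?gmat_upd.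
Qed.

Lemma pd_eq_on U f h c k : open U -> JLor U c ->
  (forall x, JLor U x -> f x = h x) -> pd k f c = pd k h c.
Proof.
move=> oU Wc fh; apply: pd_near.
by apply: filterS (near_JLor k oU Wc) => t; exact: fh.
Qed.

Lemma total_deriv_eq_on U e f h c : open U -> JLor U c ->
  (forall x, JLor U x -> f x = h x) -> total_deriv e f c = total_deriv e h c.
Proof.
move=> oU Wc fh; rewrite /total_deriv (pd_eq_on (ix e) oU Wc fh).
by congr (_ + _); apply: eq_fsbigr => J _; rewrite (pd_eq_on _ oU Wc fh).
Qed.

(** Every entry of a multi-index of order at most m is at most m. *)
Lemma finite_idx_order_le m :
  finite_set [set J : sympair n * multiidx n | (\sum_i J.2 i <= m)%N].
Proof.
pose F (x : 'I_n * 'I_n * {ffun 'I_n -> 'I_m.+1}) : sympair n * multiidx n :=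
  (spair x.1.1 x.1.2, [ffun i => val (x.2 i)]).
apply: (@sub_finite_set _ _ (F @` setT)); last first.
  by apply: finite_image; exact: finite_finset.
move=> [ab C] /= Cm; have [i [j ->]] := spair_surj ab.
exists (i, j, [ffun l => inord (C l)]) => //=; congr (_, _).
apply/ffunP => l; rewrite !ffunE /= ?ffunE inordK // ltnS (leq_trans _ Cm) //.
by rewrite (bigD1 l) //= leq_addr.
Qed.

(** A coefficient that factors through the m-jet has vanishing derivatives along
    the coordinates of order greater than m, so only finitely many are nonzero. *)
Lemma is_form_diff_at U w c s : open U -> JLor U c -> is_form (JLor U) w ->
  diff_at c (fun x => w x s).
Proof.
move=> oU Wc [sm [m [ord _]] _]; split=> [k|].
  exact: ((sm s [::] c Wc).2 k).
apply: sub_finite_set (finite_idx_order_le m) => J /=.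
apply: contraNT; rewrite -ltnNge => mJ; apply/eqP.
rewrite -[RHS](pd_cst (inr J) (w c s) c); apply: pd_near.
apply: filterS (near_JLor (inr J) oU Wc) => t Wt.
apply: (ord s) => // l lm; rewrite /upd; case: eqP => // lJ.
by move: lm; rewrite lJ /= leqNgt; case: J mJ {lJ Wt} => ab C /= ->.
Qed.

Definition voldens c : R := Num.sqrt (- \det (gmat c)).

Lemma cofactor_invmx (g : 'M[R]_n) i j : g \in unitmx ->
  cofactor g i j = \det g * invmx g j i.
Proof.
move=> ug; rewrite /invmx ug !mxE mulrA divff ?mul1r //.
by rewrite -unitfE -unitmxE.
Qed.

(** Jacobi's formula and the chain rule: the derivative of sqrt(- det g) is
    sqrt(- det g) tr(g^-1 g') / 2.  The sum runs over ordered pairs, so that both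
    entries g_ij and g_ji of an off-diagonal coordinate contribute. *)
Lemma is_derive_voldens c k : lorentzian (gmat c) ->
  is_derive (c k) (1 : R) (fun t : R => voldens (upd c k t) : R)
    (voldens c / 2 * \sum_i \sum_j (ig i j (mi0 n) == k)%:R * invmx (gmat c) j i).
Proof.
move=> Lc; have dg := det_lorentzian Lc.
have ug : gmat c \in unitmx by rewrite unitmxE unitfE lt_eqF.
pose G (t : R) := - \det (gmat c + (t - c k) *: metric_dir k).
have Gck : G (c k) = - \det (gmat c) by rewrite /G subrr scale0r addr0.
have -> : (fun t : R => voldens (upd c k t)) = Num.sqrt \o G.
  by apply/funext => t; rewrite /voldens gmat_upd.
have dG : is_derive (c k) (1 : R) G _ := is_deriveN (is_derive_det _ _ _).
have dS : is_derive (G (c k)) (1 : R) (Num.sqrt : R -> R) (2 * Num.sqrt (G (c k)))^-1.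
  by apply: is_derive1_sqrt; rewrite Gck oppr_gt0.
apply: is_derive_eq (is_derive1_comp dS dG) _; rewrite Gck -/(voldens c).
have v0 : voldens c != 0 by rewrite gt_eqF // sqrtr_gt0 oppr_gt0.
have v2 : - \det (gmat c) = voldens c ^+ 2 by rewrite sqr_sqrtr // oppr_ge0 ltW.
have -> : \sum_i \sum_j metric_dir k i j * cofactor (gmat c) i j =
  - voldens c ^+ 2 * \sum_i \sum_j (ig i j (mi0 n) == k)%:R * invmx (gmat c) j i.
  rewrite -v2 opprK big_distrr; apply: eq_bigr => i _ /=.
  rewrite big_distrr; apply: eq_bigr => j _ /=.
  by rewrite mxE cofactor_invmx // mulrCA.
by rewrite mulNr opprK; field.
Qed.

Lemma pd_voldens c k : lorentzian (gmat c) -> pd k (@voldens) c =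
  voldens c / 2 * \sum_i \sum_j (ig i j (mi0 n) == k)%:R * invmx (gmat c) j i.
Proof. by move=> Lc; apply: pd_is_derive; exact: is_derive_voldens. Qed.

Lemma diff_at_voldens c : lorentzian (gmat c) -> diff_at c (@voldens).
Proof.
move=> Lc; split=> [k|]; first by have [] := is_derive_voldens k Lc.
apply: (@sub_finite_set _ _
  ((fun ij : 'I_n * 'I_n => (spair ij.1 ij.2, mi0 n)) @` setT)); last first.
  by apply: finite_image; exact: finite_finset.
move=> J /=; rewrite pd_voldens //; apply: contra_neqP => nJ.
rewrite big1 ?mulr0 // => i _; rewrite big1 // => j _.
by case: eqP => [[eJ]|]; rewrite ?mul0r //; case: nJ; exists (i, j).
Qed.

(** The contraction Gamma^a_{ae}. *)
Definition christoffel_trace (e : 'I_n) c : R := \sum_(a < n) christoffel a a e c.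

Lemma g1C a b e c : g1 a b e c = g1 b a e c.
Proof. by rewrite /g1 igC. Qed.

Lemma christoffelC a b e c : christoffel a b e c = christoffel a e b c.
Proof.
rewrite /christoffel; congr (_ * _); apply: eq_bigr => d _.
by rewrite [g1 b e d c]g1C [g1 d b e c + _]addrC.
Qed.

(** In the contraction over a and d, g_{de,a} - g_{ae,d} is antisymmetric while
    g^{ad} is symmetric. *)
Lemma christoffel_traceE e c : christoffel_trace e c =
  2^-1 * \sum_(a < n) \sum_(d < n) invmx (gmat c) a d * g1 d a e c.
Proof.
have invC a d : invmx (gmat c) a d = invmx (gmat c) d a.
  by rewrite -[in LHS]gmat_sym -trmx_inv mxE.
rewrite /christoffel_trace /christoffel -big_distrr /=; congr (_ * _).
transitivity (\sum_(a < n) (\sum_(d < n) invmx (gmat c) a d * g1 d a e c) +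
  (\sum_(a < n) \sum_(d < n) invmx (gmat c) a d * g1 d e a c -
   \sum_(a < n) \sum_(d < n) invmx (gmat c) a d * g1 a e d c)).
  rewrite -sumrB -big_split; apply: eq_bigr => a _ /=.
  rewrite -sumrB -big_split; apply: eq_bigr => d _ /=; ring.
rewrite [X in _ - X]exchange_big [X in _ + (_ - X)](_ : _ =
  \sum_(a < n) \sum_(d < n) invmx (gmat c) a d * g1 d e a c) ?subrr ?addr0 //.
by apply: eq_bigr => a _; apply: eq_bigr => d _; rewrite invC.
Qed.

(** The metric volume form is parallel: d_e sqrt(- det g) =
    Gamma^a_{ae} sqrt(- det g). *)
Lemma total_deriv_voldens e c : lorentzian (gmat c) ->
  total_deriv e (@voldens) c = voldens c * christoffel_trace e c.
Proof.
move=> Lc; rewrite /total_deriv pd_voldens // [X in _ * X + _]big1 => [|i _]; last first.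
  by rewrite big1 // => j _; rewrite mul0r.
rewrite mulr0 add0r christoffel_traceE mulrA [X in _ = _ * X]exchange_big pair_bigA.
(* The jet coordinates are indexed by unordered pairs; spreading the summand
   over ordered pairs leaves for each (i, j) the single term g_{ij,e}. *)
pose F (ij : 'I_n * 'I_n) (J : sympair n * multiidx n) : R :=
  c (inr (J.1, mi_add J.2 e)) * (voldens c / 2 *
    ((ig ij.1 ij.2 (mi0 n) == inr J)%:R * invmx (gmat c) ij.2 ij.1)).
have F0 ij J : J != (spair ij.1 ij.2, mi0 n) -> F ij J = 0.
  move=> nJ; rewrite /F; case: eqP => [[eJ]|_]; last by rewrite mul0r !mulr0.
  by rewrite -eJ eqxx in nJ.
transitivity (\sum_(J \in [set: sympair n * multiidx n])
    \sum_(ij : 'I_n * 'I_n) F ij J).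
  apply: eq_fsbigr => J _; rewrite pd_voldens // pair_bigA !big_distrr /=.
  by apply: eq_bigr.
rewrite fsum_sum => [|ij]; last first.
  apply: (@sub_finite_set _ _ [set (spair ij.1 ij.2, mi0 n)]); last exact: finite_set1.
  by move=> J /= FJ; apply/eqP; apply: contraNT FJ => /F0 ->; rewrite eqxx.
rewrite big_distrr; apply: eq_bigr => -[i j] _ /=.
rewrite (fsum_single (F0 (i, j))) /F /= eqxx mul1r /g1 /ig; ring.
Qed.

(** The coordinate volume form dx^1 /\ ... /\ dx^n. *)
Definition dxs : jform R n := \big[@wedge R n/fun_form (fun=> 1)]_(a < n) dx a.

Lemma volE c : vol R n c = fun s => voldens c * dxs c s.
Proof. by []. Qed.

Lemma dxs_cst c c' : dxs c = dxs c'.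
Proof.
rewrite /dxs; elim/big_rec: _ => [//|a w _ IH].
by rewrite /wedge IH.
Qed.

Lemma dxs_horizontal c : horizontal (dxs c).
Proof.
rewrite /dxs; elim/big_rec: _ => [|a w _ IH]; first by case.
exact: wedge_at_dx_horizontal.
Qed.

(** dx^e anticommutes through the product until it meets its own copy. *)
Lemma wedge_dx_dxs e c s : wedge (dx e) dxs c s = 0 :> R.
Proof.
rewrite /dxs; have := mem_index_enum e; elim: (index_enum _) s => [//|a r IHr] s.
rewrite inE big_cons => /orP[/eqP <-|er]; first exact: wedge_at_coframe_sq.
rewrite [LHS]wedge_at_coframe_anti -[wedge_at (coframe (ix e) c) _]/(wedge (dx e) _ c).
have -> : wedge (dx e) (\big[@wedge R n/fun_form (fun=> 1)]_(j <- r) dx j) c = fun=> 0.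
  by apply/funext => t; exact: IHr.
by rewrite wedge_at0r oppr0.
Qed.

End JetOfMetrics.

(** * The volume form and the variational bicomplex *)

Section Divergence.
Variables (R : realType) (n : nat).
Implicit Types (c : jetpt R n) (w : jform R n) (U : set 'rV[R]_n).

Lemma Omega0_iprod W p w x b t : Omega W p 0 w -> W x -> w x (ix b :: t) = 0.
Proof.
by move=> [_ Hw] Wx; apply/eqP/negPn/negP => /(Hw _ _ Wx)[_] /=.
Qed.

Lemma Omega0_size W p w x t : Omega W p 0 w -> W x -> size t != p -> w x t = 0.
Proof.
move=> [_ Hw] Wx; apply: contraNeq => /(Hw _ _ Wx)[tp t0].
by rewrite -(count_predC (@is_vert n)) tp t0 addn0.
Qed.

Lemma total_deriv_form_sum e c I (r : seq I) (F : I -> jform R n) t :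
  (forall i s, diff_at c (fun x => F i x s)) ->
  total_deriv_form e (\sum_(i <- r) F i) c t = \sum_(i <- r) total_deriv_form e (F i) c t.
Proof.
move=> HF; rewrite /total_deriv_form big_split /=; congr (_ + _).
  rewrite -total_deriv_sum //; congr total_deriv.
  by apply/funext => x; rewrite !fct_sumE.
rewrite -shift_at_sum; congr shift_at.
by apply/funext => s; rewrite !fct_sumE.
Qed.

Lemma total_deriv_formZ e c r w t : (forall s, diff_at c (fun x => w x s)) ->
  total_deriv_form e (r *: w) c t = r * total_deriv_form e w c t.
Proof.
move=> Hw; rewrite /total_deriv_form mulrDr -shift_atZ.
by rewrite -total_derivZ.
Qed.

(** Cartan's formula on a form [w] of horizontal degree 0: [iprod a w] vanishes,
    and so do the contractions with the lift of d/dx^a of dv w and of D_e w.  In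
    iota_a dh w only the contraction of dx^a with itself survives, leaving
    D_a w. *)
Lemma Lie_vertical U a w c p : open U -> JLor U c -> Omega (JLor U) p 0 w ->
  Lie a w c = total_deriv_form a w c.
Proof.
move=> oU Wc Hw.
have w0 x b t (Wx : JLor U x) : w x (ix b :: t) = 0 := Omega0_iprod b t Hw Wx.
have pd0 k b t : pd k (fun x => w x (ix b :: t)) c = 0.
  by rewrite -[RHS](pd_cst k 0 c); apply: (pd_eq_on _ oU Wc) => x; exact: w0.
have td0 e b t : total_deriv e (fun x => w x (ix b :: t)) c = 0.
  by rewrite -[RHS](total_deriv_cst e 0 c); apply: (total_deriv_eq_on _ oU Wc) => x; exact: w0.
have sh0 e b t : shift_at e (fun t' => w c (ix b :: t')) t = 0.
  rewrite -[RHS](shift_at0 R e t); congr shift_at.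
  by apply/funext => t'; exact: w0.
have D0 e t : total_deriv_form e w c (ix a :: t) = 0.
  by rewrite /total_deriv_form td0 /= sh0 !addr0.
have Di0 e : total_deriv_form e (iprod a w) c = fun=> 0.
  by apply/funext => t; rewrite /total_deriv_form td0 sh0 addr0.
apply/funext => s.
rewrite -[LHS]/(dv w c (ix a :: s) + dh w c (ix a :: s) +
  (dv (iprod a w) c s + dh (iprod a w) c s)).
have -> : dv w c (ix a :: s) = 0.
  rewrite /dv fsbig1 // => J _; rewrite /wedge wedge_at_coframe mul0r sub0r.
  have -> : (fun t => pd_form (inr J) w c (ix a :: t)) = fun=> 0.
    by apply/funext => t; exact: pd0.
  by rewrite wedge_at0r oppr0.
have -> : dv (iprod a w) c s = 0.
  rewrite /dv fsbig1 // => J _; rewrite /wedge.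
  have -> : pd_form (inr J) (iprod a w) c = fun=> 0.
    by apply/funext => t; exact: pd0.
  by rewrite wedge_at0r.
have -> : dh (iprod a w) c s = 0.
  by rewrite dhE big1 // => e _; rewrite /wedge Di0 wedge_at0r.
rewrite !addr0 add0r dhE (bigD1 a) //= big1 => [|e ne]; rewrite /wedge wedge_at_coframe.
  have -> : (fun t => total_deriv_form a w c (ix a :: t)) = fun=> 0.
    by apply/funext => t; exact: D0.
  by rewrite eqxx wedge_at0r mul1r subr0 addr0.
have -> : (fun t => total_deriv_form e w c (ix a :: t)) = fun=> 0.
  by apply/funext => t; exact: D0.
rewrite wedge_at0r subr0; case: eqP => [[ae]|_]; last by rewrite mul0r.
by rewrite ae eqxx in ne.
Qed.

(** The list [s] records the vectors contracted into the volume form.  The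
    derivation does not see them, since it kills the dx^b and the coefficients
    of dx^1 /\ ... /\ dx^n are constant. *)
Lemma total_deriv_form_vol e c s t : lorentzian (gmat c) ->
  total_deriv_form e (fun x t' => vol R n x (s ++ t')) c t =
  christoffel_trace e c * vol R n c (s ++ t).
Proof.
move=> Lc; rewrite /total_deriv_form shift_at_horizontal ?addr0; last first.
  by move=> t' ht; rewrite volE dxs_horizontal ?mulr0 // has_cat ht orbT.
rewrite !volE mulrA [_ * voldens c]mulrC -total_deriv_voldens //.
have -> : (fun x => vol R n x (s ++ t)) = fun x => dxs c (s ++ t) * voldens x.
  by apply/funext => x; rewrite volE (dxs_cst x c) mulrC.
rewrite total_derivZ; last exact: diff_at_voldens.
by rewrite mulrC.
Qed.

Lemma diff_at_vol c s : lorentzian (gmat c) -> diff_at c (fun x => vol R n x s).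
Proof.
move=> Lc.
have -> : (fun x => vol R n x s) = fun x => dxs c s * voldens x.
  by apply/funext => x; rewrite volE (dxs_cst x c) mulrC.
by apply: diff_atM; [exact: diff_at_cst | exact: diff_at_voldens].
Qed.

Lemma wedge_dx_vol e c s : wedge_at (dx e c) (vol R n c) s = 0.
Proof.
by rewrite volE wedge_atZr -[wedge_at _ _ _]/(wedge (dx e) (@dxs R n) c s) wedge_dx_dxs mulr0.
Qed.

(** Contract dx^e /\ vol = 0, which holds because vol has top horizontal
    degree. *)
Lemma wedge_dx_iprod_vol e b c s :
  wedge_at (dx e c) (fun t => vol R n c (ix b :: t)) s = (b == e)%:R * vol R n c s.
Proof.
have /eqP := wedge_dx_vol e c (ix b :: s).
by rewrite wedge_at_coframe subr_eq0 => /eqP/esym.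
Qed.

Lemma wedge_dx_iprod2_vol e a b c s :
  wedge_at (dx e c) (fun t => vol R n c (ix b :: ix a :: t)) s =
  (a == e)%:R * vol R n c (ix b :: s) - (b == e)%:R * vol R n c (ix a :: s).
Proof.
by rewrite -(wedge_dx_iprod_vol e b c (ix a :: s)) wedge_at_coframe opprB addrC subrK.
Qed.

End Divergence.

(** * The divergence identity *)

Theorem proposition3p14 (R : realType) (n : nat) (U : set 'rV[R]_n)
    (openU : open U) (p : nat) (chi : 'I_n -> 'I_n -> jform R n)
    (chi_form : forall a b, Omega (JLor U) p 0 (chi a b))
    (chi_anti : forall a b, eq_form (JLor U) (chi a b) (- chi b a)) :
  eq_form (JLor U)
    (\sum_(a < n) \sum_(b < n) wedge (nabla a chi a b) (iprod b (vol R n)))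
    ((-1) ^+ p *: dh (\sum_(a < n) \sum_(b < n)
        2^-1 *: wedge (chi a b) (iprod a (iprod b (vol R n))))).
Proof.
move=> c Wc; have Lc := Wc.2; apply/funext => s.
(* All forms are now evaluated at the point [c]. *)
pose X a b : seq (jetidx n) -> R := chi a b c.
pose D e a b : seq (jetidx n) -> R := total_deriv_form e (chi a b) c.
pose V b : seq (jetidx n) -> R := fun t => vol R n c (ix b :: t).
pose w2 a b : seq (jetidx n) -> R := fun t => vol R n c (ix b :: ix a :: t).
pose G e : R := christoffel_trace e c.
(* The coefficient of the contracted volume forms in D_e (chi /\ vol). *)
pose Y e a b : seq (jetidx n) -> R := fun t => D e a b t + G e * X a b t.
pose xv i j b : R := wedge_at (X i j) (V b) s.
pose y e i j b : R := wedge_at (Y e i j) (V b) s.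
have dchi a b t : diff_at c (fun x => chi a b x t).
  exact: is_form_diff_at openU Wc (chi_form a b).1.
have XC a b : X a b = fun t => -1 * X b a t.
  by apply/funext => t; rewrite /X chi_anti // mulN1r.
have DC e a b : D e a b = fun t => -1 * D e b a t.
  apply/funext => t; rewrite /D /total_deriv_form mulrDr -shift_atZ -total_derivZ //.
  congr (_ + _).
    by apply: (total_deriv_eq_on _ openU Wc) => x Wx; rewrite chi_anti // mulN1r.
  by congr shift_at; exact: XC.
have xvC i j b : xv i j b = - xv j i b by rewrite /xv XC wedge_atZl mulN1r.
have yC e i j b : y e i j b = - y e j i b.
  rewrite /y -mulN1r -wedge_atZl; congr wedge_at; apply/funext => t.
  by rewrite /Y DC XC; ring.
have yE e i j b : y e i j b = wedge_at (D e i j) (V b) s + G e * xv i j b.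
  by rewrite /y wedge_atDl wedge_atZl.
have Ysize e a b t : Y e a b t != 0 -> size t = p.
  apply: contra_neq_eq => tp; rewrite /Y /X (Omega0_size (chi_form a b) Wc tp).
  rewrite mulr0 addr0 /D /total_deriv_form (@shift_at_eq_size _ _ (size t)) //.
    rewrite addr0 -[RHS](total_deriv_cst e 0 c).
    by apply: (total_deriv_eq_on _ openU Wc) => x Wx; exact: Omega0_size Wx tp.
  by move=> t' tt'; apply: (Omega0_size (chi_form a b) Wc); rewrite tt'.
(* Both sides equal the sum of (D_a chi^{ab} + Gamma^e_{ea} chi^{ab}) /\ iota_b vol. *)
transitivity (\sum_(a < n) \sum_(b < n) y a a b b).
  have nablaE a b : nabla a chi a b c = fun t => (D a a b t +
      \sum_(e < n) christoffel a a e c * X e b t) +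
      \sum_(e < n) christoffel b a e c * X a e t.
    apply/funext => t; rewrite /D -(Lie_vertical a openU Wc (chi_form a b)).
    rewrite -[LHS]/(Lie a (chi a b) c t +
      (\sum_(e < n) fscale (christoffel a a e) (chi e b)) c t +
      (\sum_(e < n) fscale (christoffel b a e) (chi a e)) c t).
    by rewrite !fct_sumE.
  rewrite !fct_sumE.
  transitivity (\sum_(a < n) \sum_(b < n) (wedge_at (D a a b) (V b) s +
      \sum_(e < n) christoffel a a e c * xv e b b +
      \sum_(e < n) christoffel b a e c * xv a e b)).
    apply: eq_bigr => a _; rewrite !fct_sumE; apply: eq_bigr => b _.
    rewrite /wedge nablaE !wedge_atDl !wedge_at_suml.
    by congr (_ + _ + _); apply: eq_bigr => e _; rewrite wedge_atZl.
  under eq_bigr => a _ do rewrite !big_split.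
  rewrite !big_split /=.
  (* Gamma^b_{ae} is symmetric in a and e, chi^{ae} antisymmetric. *)
  have -> : \sum_(a < n) \sum_(b < n) \sum_(e < n) christoffel b a e c * xv a e b = 0.
    rewrite exchange_big big1 // => b _ /=.
    set S := (LHS); suff : S = - S.
      by move/eqP; rewrite -addr_eq0 -mulr2n mulrn_eq0 => /eqP.
    rewrite {1}/S exchange_big -sumrN; apply: eq_bigr => a _ /=.
    rewrite -sumrN; apply: eq_bigr => e _.
    by rewrite christoffelC xvC mulrN.
  rewrite addr0.
  have -> : \sum_(a < n) \sum_(b < n) \sum_(e < n) christoffel a a e c * xv e b b =
            \sum_(a < n) \sum_(b < n) G a * xv a b b.
    under eq_bigr => a _ do rewrite exchange_big.
    rewrite exchange_big; apply: eq_bigr => e _ /=.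
    rewrite exchange_big; apply: eq_bigr => b _ /=.
    by rewrite -big_distrl.
  rewrite -big_split; apply: eq_bigr => a _ /=; rewrite -big_split.
  by apply: eq_bigr => b _; rewrite yE.
rewrite -[RHS]/((-1) ^+ p * dh _ c s) dhE.
have DW e : total_deriv_form e (\sum_(a < n) \sum_(b < n)
    2^-1 *: wedge (chi a b) (iprod a (iprod b (vol R n)))) c =
  fun t => \sum_(a < n) \sum_(b < n) 2^-1 * wedge_at (Y e a b) (w2 a b) t.
  have dw a b t : diff_at c (fun x =>
      wedge (chi a b) (iprod a (iprod b (vol R n))) x t).
    by apply: diff_at_wedge => t'; [exact: dchi | exact: diff_at_vol].
  have dw' a b t : diff_at c (fun x =>
      (2^-1 *: wedge (chi a b) (iprod a (iprod b (vol R n)))) x t).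
    by apply: diff_atM (dw a b t); exact: diff_at_cst.
  apply/funext => t; rewrite total_deriv_form_sum => [|a t']; last first.
    have -> : (fun x => (\sum_(b < n)
        2^-1 *: wedge (chi a b) (iprod a (iprod b (vol R n)))) x t') = (fun x =>
      \sum_(b < n) (2^-1 *: wedge (chi a b) (iprod a (iprod b (vol R n)))) x t').
      by apply/funext => x; rewrite !fct_sumE.
    exact: diff_at_sum.
  apply: eq_bigr => a _; rewrite total_deriv_form_sum //; apply: eq_bigr => b _.
  rewrite total_deriv_formZ // total_deriv_form_wedge //; last first.
    by move=> t'; exact: diff_at_vol.
  congr (_ * _).
  have -> : total_deriv_form e (iprod a (iprod b (vol R n))) c = fun t' => G e * w2 a b t'.
    by apply/funext => t'; exact: (total_deriv_form_vol e [:: ix b; ix a] t' Lc).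
  by rewrite wedge_atZr /Y wedge_atDl wedge_atZl.
(* Moving dx^e across Y, of degree p, gives the sign (-1)^p. *)
have dhW e : wedge (dx e) (total_deriv_form e (\sum_(a < n) \sum_(b < n)
    2^-1 *: wedge (chi a b) (iprod a (iprod b (vol R n))))) c s =
  \sum_(a < n) \sum_(b < n)
    (-1) ^+ p * (2^-1 * ((a == e)%:R * y e a b b - (b == e)%:R * y e a b a)).
  rewrite /wedge DW wedge_at_sumr; apply: eq_bigr => a _.
  rewrite wedge_at_sumr; apply: eq_bigr => b _.
  rewrite wedge_atZr wedge_at_coframeCA (grade_homog (Ysize e a b)) wedge_atZl mulrCA.
  congr (_ * (_ * _)).
  have -> : wedge_at (coframe (ix e) c) (w2 a b) =
      fun t => (a == e)%:R * V b t + (- (b == e)%:R) * V a t.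
    by apply/funext => t; rewrite [LHS]wedge_dx_iprod2_vol mulNr.
  by rewrite wedge_atDr (wedge_atZr _ _ (V b)) (wedge_atZr _ _ (V a)) mulNr.
under [in RHS]eq_bigr => e _ do rewrite dhW.
rewrite [in RHS]exchange_big big_distrr /=.
transitivity (\sum_(a < n) \sum_(b < n) 2^-1 * (y a a b b - y b a b a)); last first.
  apply: eq_bigr => a _; rewrite [in RHS]exchange_big big_distrr; apply: eq_bigr => b _ /=.
  rewrite -big_distrr /= mulrA -expr2 sqrr_sign mul1r -big_distrr /=; congr (_ * _).
  rewrite sumrB; congr (_ - _).
    rewrite (bigD1 a) //= eqxx mul1r big1 ?addr0 // => e.
    by rewrite eq_sym => /negPf ->; rewrite mul0r.
  rewrite (bigD1 b) //= eqxx mul1r big1 ?addr0 // => e.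
  by rewrite eq_sym => /negPf ->; rewrite mul0r.
(* By antisymmetry the two Kronecker deltas contribute equally, which cancels
   the factor 1/2. *)
have half : \sum_(a < n) \sum_(b < n) y b b a a = \sum_(a < n) \sum_(b < n) y a a b b.
  by rewrite exchange_big.
transitivity (2^-1 * (\sum_(a < n) \sum_(b < n) y a a b b + \sum_(a < n) \sum_(b < n) y b b a a)).
  by rewrite half; field.
rewrite -big_split big_distrr; apply: eq_bigr => a _ /=.
rewrite -big_split big_distrr; apply: eq_bigr => b _ /=.
by rewrite [y b a b a]yC opprK.
Qed.
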